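(* Let $(V,e)$ be an absolute matrix order unit space and consider $\mathcal{U}_\infty(V)\times\mathcal{U}_\infty(V)$. For $u_1,u_2,v_1,v_2\in\mathcal{U}_\infty(V)$ define $(u_1,v_1)\equiv_1(u_2,v_2)$ if and only if $u_1\oplus v_2\approx_1 u_2\oplus v_1$. Then $\equiv_1$ is an equivalence relation on $\mathcal{U}_\infty(V)\times\mathcal{U}_\infty(V)$. Let $K_1(V)=\{[(u,v)]:u,v\in\mathcal{U}_\infty(V)\}$, where $[(u,v)]$ is the equivalence class of $(u,v)$ with respect to $\equiv_1$, and for all $u_1,u_2,v_1,v_2\in\mathcal{U}_\infty(V)$ write $[(u_1,v_1)]+[(u_2,v_2)]=[(u_1\oplus u_2,v_1\oplus v_2)]$. Then $(K_1(V),+)$ is an abelian group (in particular $+$ is well defined).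
   Context: Matrices. For a complex $*$-vector space $V$ (complex vector space with a conjugate-linear involution $*$), $M_{m,n}(V)$ denotes the $m\times n$ matrices over $V$, $M_n(V)=M_{n,n}(V)$, $M_{m,n}=M_{m,n}(\mathbb{C})$, $M_n=M_{n,n}$; products $\alpha v$, $v\beta$ with scalar matrices are the usual ones, $[v_{i,j}]^*=[v_{j,i}^*]$, $M_n(V)_{sa}=\{v\in M_n(V):v=v^*\}$, $v\oplus w=\begin{bmatrix}v&0\\0&w\end{bmatrix}$, and $0_n$ is the zero of $M_n(V)$. A matrix ordered space is a $*$-vector space $V$ with sets $M_n(V)^+\subset M_n(V)_{sa}$ ($n\in\mathbb{N}$) such that each $(M_n(V)_{sa},M_n(V)^+)$ is a real ordered vector space ($M_n(V)^+$ is a cone: closed under sums and nonnegative scalar multiples; $u\le v$ means $v-u\in M_n(V)^+$) and $\alpha^*v\alpha\in M_m(V)^+$ for all $v\in M_n(V)^+$, $\alpha\in M_{n,m}$. Write $V^+=M_1(V)^+$. An absolutely ordered space is a real ordered vector space $(X,X^+)$ with a map $|\cdot|:X\to X^+$ such that: (1) $|x|=x$ for $x\in X^+$; (2) $|x|\pm x\in X^+$ for $x\in X$; (3) $|kx|=|k||x|$ for $k\in\mathbb{R}$; (4) if $|x-y|=x+y$ and $0\le z\le y$, then $|x-z|=x+z$; (5) if $|x-y|=x+y$ and $|x-z|=x+z$, then $\big|x-|y\pm z|\big|=x+|y\pm z|$. An absolutely matrix ordered space is a matrix ordered space with maps $|\cdot|_{m,n}:M_{m,n}(V)\to M_n(V)^+$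 (write $|\cdot|_n=|\cdot|_{n,n}$) such that: each $(M_n(V)_{sa},M_n(V)^+,|\cdot|_n)$ is an absolutely ordered space; $|\alpha v\beta|_{r,s}\le\|\alpha\|\,\big||v|_{m,n}\beta\big|_{n,s}$ for $v\in M_{m,n}(V)$, $\alpha\in M_{r,m}$, $\beta\in M_{n,s}$; and $|v\oplus w|_{m+r,n+s}=|v|_{m,n}\oplus|w|_{r,s}$ for $v\in M_{m,n}(V)$, $w\in M_{r,s}(V)$. For $u,v\in M_n(V)^+$, $u\perp v$ means $|u-v|_n=u+v$. A matrix order unit space $(V,e)$ is a matrix ordered space with an order unit $e\in V^+$ for $V_{sa}$ (every $v\in V_{sa}$ satisfies $ke\pm v\in V^+$ for some $k>0$), with $V^+$ proper ($V^+\cap(-V^+)=\{0\}$) and every $M_n(V)^+$ Archimedean (if $v\in M_n(V)_{sa}$ and $ku+v\in M_n(V)^+$ for a fixed $u\in M_n(V)^+$ and all $k>0$, then $v\in M_n(V)^+$). Put $e^n=e\oplus\cdots\oplus e\in M_n(V)$. It carries the norms $\|v\|_n=\inf\{k>0:\begin{bmatrix}ke^n&v\\ v^*&ke^n\end{bmatrix}\in M_{2n}(V)^+\}$ on $M_n(V)$; continuity is with respect to these norms. For $u,v\in M_n(V)^+$, $u\perp_\infty v$ means $\|u+kv\|_n=\max\{\|u\|_n,\|kv\|_n\}$ for all $k\in\mathbb{R}$, and $u\perp_\infty^a v$ means $u_1\perp_\infty v_1$ whenever $0\le u_1\le u$ and $0\le v_1\le v$. An absolute matrix order unit space is a matrix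 order unit space $(V,e)$ that is also an absolutely matrix ordered space and for which $\perp=\perp_\infty^a$ on $M_n(V)^+$ for every $n$. Unitaries. $u\in M_n(V)$ is unitary if $|u|_n=e^n=|u^*|_n$; $\mathcal{U}_n(V)$ is the set of unitaries in $M_n(V)$ and $\mathcal{U}_\infty(V)=\bigcup_{n=1}^\infty\mathcal{U}_n(V)$ (each element is a matrix of a definite size; $\oplus$ is a binary operation on it). For $u,v\in\mathcal{U}_n(V)$, $u\sim_h v$ means there is a continuous $f:[0,1]\to\mathcal{U}_n(V)$ with $f(0)=u$, $f(1)=v$. For $u\in\mathcal{U}_m(V)$, $v\in\mathcal{U}_n(V)$, $u\sim_1 v$ means there is $k>\max\{m,n\}$ with $u\oplus e^{k-m}\sim_h v\oplus e^{k-n}$ in $\mathcal{U}_k(V)$. For $u,v\in\mathcal{U}_\infty(V)$, $u\approx_1 v$ means there is $w\in\mathcal{U}_\infty(V)$ with $u\oplus w\sim_1 v\oplus w$. *)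

(* Defs.v *)
From HB Require Import structures.
From Corelib Require Export Classes.RelationClasses.
From mathcomp Require Export all_boot all_order all_algebra.
From mathcomp Require Export complex.
From mathcomp Require Export boolp classical_sets reals.

Set Implicit Arguments.
Unset Strict Implicit.
Unset Printing Implicit Defensive.

Import Order.TTheory GRing.Theory Num.Theory.
Local Open Scope classical_set_scope.
Local Open Scope ring_scope.
Local Open Scope complex_scope.

(* Matrix sizes range over the positive integers in this theory.  A 0 x n
   matrix exists in Rocq, so every axiom below carries explicit positivity
   hypotheses and nothing is assumed about [mpos 0], [mxabs 0 n], etc. *)

HB.mixin Record Lmodule_isStar (R : realType) V of GRing.Lmodule R[i] V := {
  star : V -> V;
  starK : involutive star;
  starD : {morph star : v w / v + w};
  starZ : forall (a : R[i]) (v : V), star (a *: v) = conjc a *: star v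
}.

#[short(type="starSpaceType")]
HB.structure Definition StarSpace (R : realType) :=
  {V of Lmodule_isStar R V & GRing.Lmodule R[i] V}.

Definition mxstar (R : realType) (V : starSpaceType R) (m n : nat)
  (v : 'M[V]_(m, n)) : 'M[V]_(n, m) := map_mx star v^T.

Definition selfadjoint (R : realType) (V : starSpaceType R) (n : nat) :
  set 'M[V]_n := [set v | mxstar v = v].

(* MathComp only provides matrix products and scalings for entries in a
   semiring; here the entries lie in a complex vector space. *)
Definition scmx (R : realType) (V : lmodType R[i]) (m n : nat)
  (k : R) (v : 'M[V]_(m, n)) : 'M[V]_(m, n) := \matrix_(i, j) (k%:C *: v i j).

Definition lmulV (R : realType) (V : lmodType R[i]) (r m n : nat)
  (a : 'M[R[i]]_(r, m)) (v : 'M[V]_(m, n)) : 'M[V]_(r, n) :=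
  \matrix_(i, j) \sum_k a i k *: v k j.

Definition rmulV (R : realType) (V : lmodType R[i]) (m n s : nat)
  (v : 'M[V]_(m, n)) (b : 'M[R[i]]_(n, s)) : 'M[V]_(m, s) :=
  \matrix_(i, j) \sum_k b k j *: v i k.

Definition dsum (R : realType) (V : lmodType R[i]) (m n r s : nat)
  (v : 'M[V]_(m, n)) (w : 'M[V]_(r, s)) : 'M[V]_(m + r, n + s) :=
  block_mx v 0 0 w.

Definition adjmx (R : realType) (m n : nat) (a : 'M[R[i]]_(m, n)) :
  'M[R[i]]_(n, m) := map_mx conjc a^T.

Definition l2norm (R : realType) (n : nat) (x : 'cV[R[i]]_n) : R :=
  Num.sqrt (\sum_i (Normc.normc (x i 0)) ^+ 2).

Definition opnorm (R : realType) (m n : nat) (a : 'M[R[i]]_(m, n)) : R :=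
  sup [set l2norm (a *m x) | x in [set x : 'cV[R[i]]_n | l2norm x <= 1]].

Definition is_cone (R : realType) (W : zmodType) (sc : R -> W -> W)
    (P : set W) : Prop :=
  [/\ P 0,
      forall u v, P u -> P v -> P (u + v)
    & forall (k : R) u, 0 <= k -> P u -> P (sc k u)].

(* [X] is the carrier, viewed as a real subspace of [W], and [sc] the real
   scalar multiplication. *)
Record absolutely_ordered (R : realType) (W : zmodType) (sc : R -> W -> W)
    (X P : set W) (abs : W -> W) : Prop := {
  ao_cone : is_cone sc P;
  ao_sub : P `<=` X;
  ao_abs : forall x, X x -> P (abs x);
  ao_id : forall x, P x -> abs x = x;
  ao_pm : forall x, X x -> P (abs x + x) /\ P (abs x - x);
  ao_scale : forall (k : R) x, X x -> abs (sc k x) = sc `|k| (abs x);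
  ao_le : forall x y z, X x -> X y -> X z ->
    abs (x - y) = x + y -> P z -> P (y - z) -> abs (x - z) = x + z;
  ao_add : forall x y z, X x -> X y -> X z ->
    abs (x - y) = x + y -> abs (x - z) = x + z ->
    abs (x - abs (y + z)) = x + abs (y + z) /\
    abs (x - abs (y - z)) = x + abs (y - z)
}.

HB.mixin Record StarSpace_isMatrixOrdered (R : realType) V
    of StarSpace R V := {
  mpos : forall n, set 'M[V]_n;
  mpos_selfadjoint : forall n, (0 < n)%N -> mpos n `<=` @selfadjoint R V n;
  mpos_cone : forall n, (0 < n)%N -> is_cone (@scmx R V n n) (mpos n);
  mpos_compat : forall m n (v : 'M[V]_n) (a : 'M[R[i]]_(n, m)),
    (0 < m)%N -> (0 < n)%N -> mpos n v -> mpos m (rmulV (lmulV (adjmx a) v) a)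
}.

#[short(type="matrixOrderedType")]
HB.structure Definition MatrixOrdered (R : realType) :=
  {V of StarSpace_isMatrixOrdered R V & StarSpace R V}.

Arguments mpos {R s n}.

Definition mle (R : realType) (V : matrixOrderedType R) (n : nat)
  (u v : 'M[V]_n) : Prop := mpos (v - u).

(* V is identified with the 1 x 1 matrices over V. *)
Definition vpos (R : realType) (V : matrixOrderedType R) : set V :=
  [set v : V | mpos (const_mx v : 'M[V]_1)].

HB.mixin Record MatrixOrdered_isAbsolute (R : realType) V
    of MatrixOrdered R V := {
  mxabs : forall m n, 'M[V]_(m, n) -> 'M[V]_n;
  mxabs_pos : forall m n (v : 'M[V]_(m, n)), (0 < m)%N -> (0 < n)%N ->
    mpos (mxabs m n v);
  mxabs_ordered : forall n, (0 < n)%N ->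
    absolutely_ordered (@scmx R V n n) (@selfadjoint R V n) (@mpos R V n)
      (mxabs n n);
  mxabs_mul : forall m n p q
      (v : 'M[V]_(m, n)) (a : 'M[R[i]]_(p, m)) (b : 'M[R[i]]_(n, q)),
    (0 < m)%N -> (0 < n)%N -> (0 < p)%N -> (0 < q)%N ->
    mle (mxabs p q (rmulV (lmulV a v) b))
        (scmx (opnorm a) (mxabs n q (rmulV (mxabs m n v) b)));
  mxabs_dsum : forall m n p q (v : 'M[V]_(m, n)) (w : 'M[V]_(p, q)),
    (0 < m)%N -> (0 < n)%N -> (0 < p)%N -> (0 < q)%N ->
    mxabs (m + p) (n + q) (dsum v w) = dsum (mxabs m n v) (mxabs p q w)
}.

#[short(type="absMatrixOrderedType")]
HB.structure Definition AbsMatrixOrdered (R : realType) :=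
  {V of MatrixOrdered_isAbsolute R V & MatrixOrdered R V}.

Arguments mxabs {R s m n}.

Definition perp (R : realType) (V : absMatrixOrderedType R) (n : nat)
  (u v : 'M[V]_n) : Prop := mxabs (u - v) = u + v.

HB.mixin Record MatrixOrdered_hasOrderUnit (R : realType) V
    of MatrixOrdered R V := {
  ounit : V;
  ounit_pos : vpos ounit;
  ounitP : forall v : V, star v = v -> exists2 k : R, 0 < k &
    vpos (k%:C *: ounit + v) /\ vpos (k%:C *: ounit - v);
  vpos_proper : forall v : V, vpos v -> vpos (- v) -> v = 0;
  mpos_archimedean : forall n (u v : 'M[V]_n), (0 < n)%N ->
    mpos u -> selfadjoint v ->
    (forall k : R, 0 < k -> mpos (scmx k u + v)) -> mpos v
}.

#[short(type="matrixOrderUnitType")]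
HB.structure Definition MatrixOrderUnit (R : realType) :=
  {V of MatrixOrdered_hasOrderUnit R V & MatrixOrdered R V}.

Definition munit (R : realType) (V : matrixOrderUnitType R) (n : nat) :
  'M[V]_n := diag_mx (const_mx ounit).

Definition mnorm (R : realType) (V : matrixOrderUnitType R) (n : nat)
    (v : 'M[V]_n) : R :=
  inf [set k : R | 0 < k /\
    mpos (block_mx (scmx k (munit V n)) v (mxstar v) (scmx k (munit V n)))].

Definition perp_inf (R : realType) (V : matrixOrderUnitType R) (n : nat)
    (u v : 'M[V]_n) : Prop :=
  forall k : R, mnorm (u + scmx k v) = Num.max (mnorm u) (mnorm (scmx k v)).

Definition abs_perp_inf (R : realType) (V : matrixOrderUnitType R)
    (n : nat) (u v : 'M[V]_n) : Prop :=
  forall u1 v1 : 'M[V]_n, mpos u1 -> mle u1 u -> mpos v1 -> mle v1 v ->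
    perp_inf u1 v1.

HB.mixin Record isAbsMatrixOrderUnit (R : realType) V
    of AbsMatrixOrdered R V & MatrixOrderUnit R V := {
  perpE : forall n (u v : 'M[V]_n), (0 < n)%N -> mpos u -> mpos v ->
    (perp u v <-> abs_perp_inf u v)
}.

#[short(type="absMatrixOrderUnitType")]
HB.structure Definition AbsMatrixOrderUnit (R : realType) :=
  {V of isAbsMatrixOrderUnit R V & AbsMatrixOrdered R V & MatrixOrderUnit R V}.

Definition is_unitary (R : realType) (V : absMatrixOrderUnitType R) (n : nat)
  (u : 'M[V]_n) : Prop := mxabs u = munit V n /\ mxabs (mxstar u) = munit V n.

Record unitary (R : realType) (V : absMatrixOrderUnitType R) := Unitary {
  usize : nat;
  uval : 'M[V]_usize;
  usize_gt0 : (0 < usize)%N;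
  unitaryP : is_unitary uval
}.

Lemma star0 (R : realType) (V : starSpaceType R) : star (0 : V) = 0.
Proof. by apply: (addrI (star 0)); rewrite -starD !addr0. Qed.

Lemma mxstar_dsum (R : realType) (V : starSpaceType R) (m n r s : nat)
    (v : 'M[V]_(m, n)) (w : 'M[V]_(r, s)) :
  mxstar (dsum v w) = dsum (mxstar v) (mxstar w).
Proof.
rewrite /mxstar /dsum tr_block_mx map_block_mx !trmx0.
by congr block_mx; apply/matrixP=> i j; rewrite !mxE star0.
Qed.

Lemma munit_dsum (R : realType) (V : matrixOrderUnitType R) (m n : nat) :
  dsum (munit V m) (munit V n) = munit V (m + n).
Proof. by rewrite /dsum /munit -diag_mx_row row_mx_const. Qed.

Lemma is_unitary_dsum (R : realType) (V : absMatrixOrderUnitType R) (m n : nat)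
    (u : 'M[V]_m) (v : 'M[V]_n) : (0 < m)%N -> (0 < n)%N ->
  is_unitary u -> is_unitary v -> is_unitary (dsum u v).
Proof.
move=> m0 n0 [u1 u2] [v1 v2]; split.
  by rewrite mxabs_dsum // u1 v1 munit_dsum.
by rewrite mxstar_dsum mxabs_dsum // u2 v2 munit_dsum.
Qed.

Definition udsum (R : realType) (V : absMatrixOrderUnitType R)
    (u v : unitary V) : unitary V :=
  Unitary (ltn_addr (usize v) (usize_gt0 u))
    (is_unitary_dsum (usize_gt0 u) (usize_gt0 v) (unitaryP u) (unitaryP v)).

(* A path is given by a function on all of R of which only the values on
   [0, 1] matter; the last clause is continuity on [0, 1] for [mnorm]. *)
Definition homotopic (R : realType) (V : absMatrixOrderUnitType R) (n : nat)
    (u v : 'M[V]_n) : Prop :=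
  exists f : R -> 'M[V]_n,
    [/\ f 0 = u, f 1 = v,
        forall t : R, 0 <= t <= 1 -> is_unitary (f t)
      & forall t : R, 0 <= t <= 1 -> forall eps : R, 0 < eps ->
          exists2 delta : R, 0 < delta & forall s : R, 0 <= s <= 1 ->
            `|s - t| < delta -> mnorm (f s - f t) < eps].

(* u (+) e^(k - m), transported to size k along m + (k - m) = k. *)
Definition pad (R : realType) (V : matrixOrderUnitType R) (m k : nat)
    (mk : (m < k)%N) (u : 'M[V]_m) : 'M[V]_k :=
  castmx (subnKC (ltnW mk), subnKC (ltnW mk)) (dsum u (munit V (k - m))).

Definition sim1 (R : realType) (V : absMatrixOrderUnitType R)
    (u v : unitary V) : Prop :=
  exists (k : nat) (mk : (usize u < k)%N) (nk : (usize v < k)%N),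
    homotopic (pad mk (uval u)) (pad nk (uval v)).

Definition approx1 (R : realType) (V : absMatrixOrderUnitType R)
    (u v : unitary V) : Prop :=
  exists w : unitary V, sim1 (udsum u w) (udsum v w).

Definition equiv1 (R : realType) (V : absMatrixOrderUnitType R)
    (p q : unitary V * unitary V) : Prop :=
  approx1 (udsum p.1 q.2) (udsum q.1 p.2).

Definition K1_class_set (R : realType) (V : absMatrixOrderUnitType R)
    (p : unitary V * unitary V) : set (unitary V * unitary V) :=
  [set q | equiv1 p q].

Definition K1 (R : realType) (V : absMatrixOrderUnitType R) : Type :=
  {A : set (unitary V * unitary V) | exists p, A = K1_class_set p}.

Definition K1_class (R : realType) (V : absMatrixOrderUnitType R)
    (u v : unitary V) : K1 V :=
  exist _ (K1_class_set (u, v)) (ex_intro _ (u, v) erefl).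

Definition is_abelian_group (G : Type) (add : G -> G -> G) : Prop :=
  [/\ associative add, commutative add
    & exists (zero : G) (opp : G -> G),
        left_id zero add /\ left_inverse zero opp add].

(* Main.v *)
Require Import Defs.
From Corelib Require Import Setoid Morphisms.
From mathcomp Require Import ring lra zify.

(* Up to homotopy and stabilisation, [udsum] is associative and commutative, so
   K_1 is the Grothendieck group of a commutative semigroup.  Commutativity is
   the only analytic point.  Multiplying by a scalar unitary on either side
   preserves unitaries of V, because |a v b| <= ||a|| ||v| b| applied to the
   scalar unitaries and to their inverses forces equality.  If T is a
   skew-adjoint scalar unitary, then cos(t) + sin(t) T is a unitary path, so u
   is homotopic to Tu and to uT.  With T = iS, where S reverses the order of the
   basis, every unitary is homotopic to its reversal SuS.  Reversing u (+) v
   and then reversing each of the two summands back yields v (+) u. *)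

Set Implicit Arguments.
Unset Strict Implicit.
Unset Printing Implicit Defensive.

Import Order.TTheory GRing.Theory Num.Theory.
Local Open Scope classical_set_scope.
Local Open Scope ring_scope.
Local Open Scope complex_scope.

(** * Real scalars and scalar matrices acting on matrices over [V] *)

Lemma scmxA (R : realType) (V : lmodType R[i]) m n
    (k l : R) (v : 'M[V]_(m, n)) :
  scmx k (scmx l v) = scmx (k * l) v.
Proof. by apply/matrixP=> i j; rewrite !mxE scalerA rmorphM. Qed.

Lemma scmx1 (R : realType) (V : lmodType R[i]) m n (v : 'M[V]_(m, n)) :
  scmx 1 v = v.
Proof. by apply/matrixP=> i j; rewrite !mxE rmorph1 scale1r. Qed.

Lemma scmxDl (R : realType) (V : lmodType R[i]) m n
    (k l : R) (v : 'M[V]_(m, n)) :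
  scmx (k + l) v = scmx k v + scmx l v.
Proof. by apply/matrixP=> i j; rewrite !mxE rmorphD scalerDl. Qed.

Lemma scmxDr (R : realType) (V : lmodType R[i]) m n
    (k : R) (v w : 'M[V]_(m, n)) :
  scmx k (v + w) = scmx k v + scmx k w.
Proof. by apply/matrixP=> i j; rewrite !mxE scalerDr. Qed.

Lemma scmxNl (R : realType) (V : lmodType R[i]) m n (k : R) (v : 'M[V]_(m, n)) :
  scmx (- k) v = - scmx k v.
Proof. by apply/matrixP=> i j; rewrite !mxE rmorphN scaleNr. Qed.

Lemma scmx0l (R : realType) (V : lmodType R[i]) m n (v : 'M[V]_(m, n)) :
  scmx 0 v = 0.
Proof. by apply/matrixP=> i j; rewrite !mxE scale0r. Qed.

Lemma scmx_block (R : realType) (V : lmodType R[i]) m n p q (k : R)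
    (a : 'M[V]_(m, p)) (b : 'M[V]_(m, q))
    (c : 'M[V]_(n, p)) (d : 'M[V]_(n, q)) :
  scmx k (block_mx a b c d) =
  block_mx (scmx k a) (scmx k b) (scmx k c) (scmx k d).
Proof.
apply/matrixP=> i j; rewrite !mxE.
by case: split => i'; rewrite !mxE; case: split => j'; rewrite !mxE.
Qed.

Lemma scmxNr (R : realType) (V : lmodType R[i]) m n (k : R) (v : 'M[V]_(m, n)) :
  scmx k (- v) = - scmx k v.
Proof. by apply/matrixP=> i j; rewrite !mxE scalerN. Qed.

Lemma scmx_dsum (R : realType) (V : lmodType R[i]) m n p q (k : R)
    (v : 'M[V]_(m, p)) (w : 'M[V]_(n, q)) :
  scmx k (dsum v w) = dsum (scmx k v) (scmx k w).
Proof.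
rewrite /dsum scmx_block; congr block_mx;
  by apply/matrixP=> i j; rewrite !mxE scaler0.
Qed.

Lemma opp_dsum (R : realType) (V : lmodType R[i]) m n p q
    (v : 'M[V]_(m, p)) (w : 'M[V]_(n, q)) : - dsum v w = dsum (- v) (- w).
Proof. by rewrite /dsum opp_block_mx !oppr0. Qed.

Lemma add_dsum (R : realType) (V : lmodType R[i]) m n p q
    (v v' : 'M[V]_(m, p)) (w w' : 'M[V]_(n, q)) :
  dsum v w + dsum v' w' = dsum (v + v') (w + w').
Proof. by rewrite /dsum add_block_mx !addr0. Qed.

Lemma lmulVA (R : realType) (V : lmodType R[i]) m n p q
    (a : 'M[R[i]]_(m, n)) (b : 'M[R[i]]_(n, p)) (v : 'M[V]_(p, q)) :
  lmulV a (lmulV b v) = lmulV (a *m b) v.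
Proof.
apply/matrixP=> i j; rewrite !mxE.
under eq_bigr do rewrite mxE scaler_sumr.
rewrite exchange_big; apply: eq_bigr => k _.
by rewrite mxE scaler_suml; apply: eq_bigr => l _; rewrite scalerA.
Qed.

Lemma rmulVE (R : realType) (V : lmodType R[i]) m n p
    (v : 'M[V]_(m, n)) (b : 'M[R[i]]_(n, p)) :
  rmulV v b = (lmulV b^T v^T)^T.
Proof.
by apply/matrixP=> i j; rewrite !mxE; apply: eq_bigr => k _; rewrite !mxE.
Qed.

Lemma rmulVA (R : realType) (V : lmodType R[i]) m n p q
    (v : 'M[V]_(m, n)) (a : 'M[R[i]]_(n, p)) (b : 'M[R[i]]_(p, q)) :
  rmulV (rmulV v a) b = rmulV v (a *m b).
Proof. by rewrite !rmulVE trmxK lmulVA trmx_mul. Qed.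

Lemma lmulV_scalar (R : realType) (V : lmodType R[i]) m n (a : R[i])
    (v : 'M[V]_(m, n)) :
  lmulV a%:M v = \matrix_(i, j) (a *: v i j).
Proof.
apply/matrixP=> i j; rewrite !mxE (bigD1 i) //= !mxE eqxx big1 ?addr0 //.
by move=> k /negPf ki; rewrite !mxE eq_sym ki scale0r.
Qed.

Lemma lmul1V (R : realType) (V : lmodType R[i]) m n (v : 'M[V]_(m, n)) :
  lmulV 1%:M v = v.
Proof. by apply/matrixP=> i j; rewrite lmulV_scalar mxE scale1r. Qed.

Lemma rmulV1 (R : realType) (V : lmodType R[i]) m n (v : 'M[V]_(m, n)) :
  rmulV v 1%:M = v.
Proof. by rewrite rmulVE trmx1 lmul1V trmxK. Qed.

Lemma lmulVDl (R : realType) (V : lmodType R[i]) m n p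
    (a b : 'M[R[i]]_(m, n)) (v : 'M[V]_(n, p)) :
  lmulV (a + b) v = lmulV a v + lmulV b v.
Proof.
apply/matrixP=> i j; rewrite !mxE -big_split /=.
by apply: eq_bigr => k _; rewrite mxE scalerDl.
Qed.

Lemma lmulVBr (R : realType) (V : lmodType R[i]) m n p
    (a : 'M[R[i]]_(m, n)) (v w : 'M[V]_(n, p)) :
  lmulV a (v - w) = lmulV a v - lmulV a w.
Proof.
apply/matrixP=> i j; rewrite !mxE -sumrB.
by apply: eq_bigr => k _; rewrite !mxE scalerBr.
Qed.

Lemma rmulVDr (R : realType) (V : lmodType R[i]) m n p
    (v : 'M[V]_(m, n)) (a b : 'M[R[i]]_(n, p)) :
  rmulV v (a + b) = rmulV v a + rmulV v b.
Proof. by rewrite !rmulVE raddfD /= lmulVDl raddfD. Qed.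

Lemma rmulVBl (R : realType) (V : lmodType R[i]) m n p
    (v w : 'M[V]_(m, n)) (a : 'M[R[i]]_(n, p)) :
  rmulV (v - w) a = rmulV v a - rmulV w a.
Proof. by rewrite !rmulVE raddfB /= lmulVBr raddfB. Qed.

Lemma lrmulVA (R : realType) (V : lmodType R[i]) m n p q
    (a : 'M[R[i]]_(m, n)) (v : 'M[V]_(n, p)) (b : 'M[R[i]]_(p, q)) :
  lmulV a (rmulV v b) = rmulV (lmulV a v) b.
Proof.
apply/matrixP=> i j; rewrite !mxE.
under eq_bigr do rewrite mxE scaler_sumr.
rewrite exchange_big; apply: eq_bigr => k _.
rewrite mxE scaler_sumr; apply: eq_bigr => l _.
by rewrite !scalerA mulrC.
Qed.

Lemma lmulV_scmx (R : realType) (V : lmodType R[i]) m n p (k : R)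
    (a : 'M[R[i]]_(m, n)) (v : 'M[V]_(n, p)) :
  lmulV (k%:C *: a) v = scmx k (lmulV a v).
Proof.
apply/matrixP=> i j; rewrite !mxE scaler_sumr.
by apply: eq_bigr => l _; rewrite mxE scalerA.
Qed.

Lemma rmulV_scmx (R : realType) (V : lmodType R[i]) m n p (k : R)
    (v : 'M[V]_(m, n)) (a : 'M[R[i]]_(n, p)) :
  rmulV v (k%:C *: a) = scmx k (rmulV v a).
Proof.
by apply/matrixP=> i j; rewrite rmulVE linearZ lmulV_scmx rmulVE !mxE.
Qed.

(** * The involution on matrices over [V] *)

Lemma star_sum (R : realType) (V : starSpaceType R) (I : finType)
    (F : I -> V) : star (\sum_i F i) = \sum_i star (F i).
Proof. exact: (big_morph _ (@starD R V) (star0 V)). Qed.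

Lemma mxstarK (R : realType) (V : starSpaceType R) m n :
  cancel (@mxstar R V m n) (@mxstar R V n m).
Proof. by move=> v; apply/matrixP=> i j; rewrite !mxE starK. Qed.

Lemma mxstar0 (R : realType) (V : starSpaceType R) m n :
  mxstar (0 : 'M[V]_(m, n)) = 0.
Proof. by apply/matrixP=> i j; rewrite !mxE star0. Qed.

Lemma mxstarD (R : realType) (V : starSpaceType R) m n :
  {morph @mxstar R V m n : v w / v + w}.
Proof. by move=> v w; apply/matrixP=> i j; rewrite !mxE starD. Qed.

Lemma mxstar_scmx (R : realType) (V : starSpaceType R) m n k
    (v : 'M[V]_(m, n)) :
  mxstar (scmx k v) = scmx k (mxstar v).
Proof. by apply/matrixP=> i j; rewrite !mxE starZ conjc_real. Qed.

Lemma mxstar_lmulV (R : realType) (V : starSpaceType R) m n p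
    (a : 'M[R[i]]_(m, n)) (v : 'M[V]_(n, p)) :
  mxstar (lmulV a v) = rmulV (mxstar v) (adjmx a).
Proof.
apply/matrixP=> i j; rewrite !mxE star_sum.
by apply: eq_bigr => k _; rewrite !mxE starZ.
Qed.

Lemma mxstar_rmulV (R : realType) (V : starSpaceType R) m n p
    (v : 'M[V]_(m, n)) (a : 'M[R[i]]_(n, p)) :
  mxstar (rmulV v a) = lmulV (adjmx a) (mxstar v).
Proof.
apply/matrixP=> i j; rewrite !mxE star_sum.
by apply: eq_bigr => k _; rewrite !mxE starZ.
Qed.

(** * Adjoints and isometries among scalar matrices *)

Lemma adjmxK (R : realType) m n : cancel (@adjmx R m n) (@adjmx R n m).
Proof. by move=> a; apply/matrixP=> i j; rewrite !mxE conjcK. Qed.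

Lemma adjmx_mul (R : realType) m n p (a : 'M[R[i]]_(m, n)) (b : 'M_(n, p)) :
  adjmx (a *m b) = adjmx b *m adjmx a.
Proof. by rewrite /adjmx trmx_mul map_mxM. Qed.

Lemma adjmx1 (R : realType) n : adjmx (1%:M : 'M[R[i]]_n) = 1%:M.
Proof. by rewrite /adjmx trmx1 map_mx1. Qed.

Definition isometry (R : realType) m n (a : 'M[R[i]]_(m, n)) : Prop :=
  adjmx a *m a = 1%:M.

(** Since [a* a = 1], one has [(a x)* (a x) = x* x], so multiplication by [a] preserves [l2norm] and
    maps the unit ball into the unit ball. *)
Lemma opnorm_isometry (R : realType) m n (a : 'M[R[i]]_(m, n)) :
  isometry a -> opnorm a <= 1.
Proof.
have l2E k (x : 'cV[R[i]]_k) : (adjmx x *m x) 0 0 =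
    (\sum_i Normc.normc (x i 0) ^+ 2)%:C.
  rewrite mxE rmorph_sum; apply: eq_bigr => i _; rewrite !mxE.
  case: (x i 0) => c d; rewrite sqr_sqrtr ?addr_ge0 ?sqr_ge0 //.
  by simpc; congr (_ +i* _); ring.
have l2norm_mul (x : 'cV[R[i]]_n) : isometry a -> l2norm (a *m x) = l2norm x.
  move=> aI; congr Num.sqrt; apply: complexI.
  by rewrite -!l2E adjmx_mul mulmxA -(mulmxA (adjmx x)) aI mulmx1.
move=> aI; apply: ge_sup => [|_ [x xle1 <-]]; last by rewrite l2norm_mul.
(* The bound on a supremum asks for a nonempty set; [x = 0] lies in the unit ball. *)
exists (l2norm (a *m 0)), 0; rewrite //= /l2norm big1 ?sqrtr0 ?ler01 // => i _.
by rewrite mxE Normc.normc0 expr0n.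
Qed.

(** * Order and absolute value on matrices *)

Lemma mposD (R : realType) (V : matrixOrderedType R) n (u v : 'M[V]_n) :
  (0 < n)%N -> mpos u -> mpos v -> mpos (u + v).
Proof. by move=> n0; case: (mpos_cone (s := V) _ n0) => _ + _; apply. Qed.

Lemma mposZ (R : realType) (V : matrixOrderedType R) n (k : R) (u : 'M[V]_n) :
  (0 < n)%N -> 0 <= k -> mpos u -> mpos (scmx k u).
Proof. by move=> n0; case: (mpos_cone (s := V) _ n0) => _ _; apply. Qed.

Lemma mle_trans (R : realType) (V : matrixOrderedType R) n (u v w : 'M[V]_n) :
  (0 < n)%N -> mle u v -> mle v w -> mle u w.
Proof.
by move=> n0 uv vw; rewrite /mle -(subrKA v); apply: mposD.
Qed.

Lemma mle_conj (R : realType) (V : matrixOrderedType R) m n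
    (a : 'M[R[i]]_(n, m)) (u v : 'M[V]_n) : (0 < m)%N -> (0 < n)%N ->
  mle u v -> mle (rmulV (lmulV (adjmx a) u) a) (rmulV (lmulV (adjmx a) v) a).
Proof.
by move=> m0 n0 uv; rewrite /mle -rmulVBl -lmulVBr; apply: mpos_compat.
Qed.

Lemma mxabs_id (R : realType) (V : absMatrixOrderedType R) n (u : 'M[V]_n) :
  (0 < n)%N -> mpos u -> mxabs u = u.
Proof. by move=> n0; apply: (ao_id (mxabs_ordered _ n0)). Qed.

(* [u = |u| = |-u| = -u] *)
Lemma mpos_proper (R : realType) (V : absMatrixOrderedType R) n (u : 'M[V]_n) :
  (0 < n)%N -> mpos u -> mpos (- u) -> u = 0.
Proof.
move=> n0 up un.
have uE : u = - u.
  rewrite -{1}(mxabs_id n0 up) -(mxabs_id n0 un).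
  have /(ao_scale (mxabs_ordered _ n0) (-1)) := mpos_selfadjoint _ n0 _ up.
  by rewrite normrN1 scmxNl !scmx1 => ->.
apply/matrixP=> i j; have /matrixP/(_ i j) := uE; rewrite !mxE => /eqP.
rewrite -addr_eq0 -mulr2n -scaler_nat scaler_eq0 pnatr_eq0 /=.
by move=> /eqP.
Qed.

Lemma mle_anti (R : realType) (V : absMatrixOrderedType R) n (u v : 'M[V]_n) :
  (0 < n)%N -> mle u v -> mle v u -> u = v.
Proof.
move=> n0 uv vu; apply/eqP; rewrite -subr_eq0; apply/eqP.
by apply: mpos_proper; rewrite // opprB.
Qed.

Lemma mle_mxabs_mul (R : realType) (V : absMatrixOrderedType R) m n p q
    (a : 'M[R[i]]_(p, m)) (v : 'M[V]_(m, n)) (b : 'M[R[i]]_(n, q)) :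
  (0 < m)%N -> (0 < n)%N -> (0 < p)%N -> (0 < q)%N -> isometry a ->
  mle (mxabs (rmulV (lmulV a v) b)) (mxabs (rmulV (mxabs v) b)).
Proof.
move=> m0 n0 p0 q0 aI.
apply: mle_trans (mxabs_mul _ _ _ _ _ _ _ m0 n0 p0 q0) _ => //.
set w := mxabs (rmulV _ b); rewrite /mle -{1}(scmx1 w) -scmxNl -scmxDl.
by apply: mposZ; rewrite ?subr_ge0 ?opnorm_isometry //; apply: mxabs_pos.
Qed.

(** One inequality comes from [a]; the other comes from [adjmx a] applied to [a v], because
    [v = a* (a v)]. Antisymmetry of the order concludes. *)
Lemma mxabs_lmulV (R : realType) (V : absMatrixOrderedType R) m n p
    (a : 'M[R[i]]_(p, m)) (v : 'M[V]_(m, n)) :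
  (0 < m)%N -> (0 < n)%N -> (0 < p)%N -> isometry a -> isometry (adjmx a) ->
  mxabs (lmulV a v) = mxabs v.
Proof.
move=> m0 n0 p0 aI aJ.
have le q r (c : 'M[R[i]]_(q, r)) (w : 'M[V]_(r, n)) : (0 < q)%N -> (0 < r)%N ->
    isometry c -> mle (mxabs (lmulV c w)) (mxabs w).
  move=> q0 r0 cI; have := mle_mxabs_mul w 1%:M r0 n0 q0 n0 cI.
  by rewrite !rmulV1 (@mxabs_id _ _ _ (mxabs w)) //; apply: mxabs_pos.
apply: mle_anti => //; first exact: le.
by rewrite -{1}(lmul1V v) -aI -lmulVA; apply: le.
Qed.

(** * Positivity of block matrices *)

(** Positive matrices equal their absolute values, so [dsum u v] is the absolute value of a
    matrix. *)
Lemma mpos_dsum (R : realType) (V : absMatrixOrderedType R) m n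
    (u : 'M[V]_m) (v : 'M[V]_n) : (0 < m)%N -> (0 < n)%N ->
  mpos u -> mpos v -> mpos (dsum u v).
Proof.
move=> m0 n0 up vp; rewrite -(mxabs_id m0 up) -(mxabs_id n0 vp) -mxabs_dsum //.
by apply: mxabs_pos; rewrite addn_gt0 m0.
Qed.

(* Compression by the matrix with entries [(i == f j)%:R * d j]. *)
Lemma mpos_mxsub (R : realType) (V : matrixOrderedType R) m n
    (f : 'I_m -> 'I_n) (d : 'I_m -> R) (u : 'M[V]_n) :
  (0 < m)%N -> (0 < n)%N -> mpos u ->
  mpos (\matrix_(i, j) ((d i * d j)%:C *: u (f i) (f j))).
Proof.
move=> m0 n0 up.
pose a : 'M[R[i]]_(n, m) := \matrix_(i, j) (d j *+ (i == f j))%:C.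
suff -> : \matrix_(i, j) ((d i * d j)%:C *: u (f i) (f j)) =
  rmulV (lmulV (adjmx a) u) a by exact: mpos_compat.
apply/matrixP=> i j; rewrite !mxE (bigD1 (f j)) //= big1 ?addr0.
  rewrite !mxE eqxx (bigD1 (f i)) //= big1 ?addr0.
    by rewrite !mxE eqxx conjc_real scalerA !mulr1n mulrC rmorphM.
  by move=> k /negPf kf; rewrite !mxE kf mulr0n conjc_real scale0r.
by move=> k /negPf kf; rewrite !mxE kf mulr0n scale0r.
Qed.

Lemma mpos_ulsub (R : realType) (V : matrixOrderedType R) m n
    (u : 'M[V]_(m + n)) : (0 < m)%N -> mpos u -> mpos (ulsubmx u).
Proof.
move=> m0 up.
suff -> : ulsubmx u =
    \matrix_(i, j) ((1 * 1)%:C *: u (lshift n i) (lshift n j)).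
  by apply: (mpos_mxsub (lshift n) (fun=> 1)); rewrite ?addn_gt0 ?m0.
by apply/matrixP=> i j; rewrite !mxE mulr1 scale1r.
Qed.

Lemma mpos_drsub (R : realType) (V : matrixOrderedType R) m n
    (u : 'M[V]_(m + n)) : (0 < n)%N -> mpos u -> mpos (drsubmx u).
Proof.
move=> n0 up.
suff -> : drsubmx u =
    \matrix_(i, j) ((1 * 1)%:C *: u (rshift m i) (rshift m j)).
  by apply: (mpos_mxsub (@rshift m n) (fun=> 1)); rewrite ?addn_gt0 ?n0 ?orbT.
by apply/matrixP=> i j; rewrite !mxE mulr1 scale1r.
Qed.

(** The sign change is conjugation by the diagonal matrix with entries 1 on the first block and -1
    on the second. *)
Lemma mpos_block_sign (R : realType) (V : matrixOrderedType R) m n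
    (a : 'M[V]_m) (b : 'M[V]_(m, n)) (c : 'M[V]_(n, m)) (d : 'M[V]_n) :
  (0 < m)%N -> mpos (block_mx a b c d) -> mpos (block_mx a (- b) (- c) d).
Proof.
move=> m0 up.
pose e (i : 'I_(m + n)) : R := if split i is inl _ then 1 else -1.
have mn0 : (0 < m + n)%N by rewrite addn_gt0 m0.
have := mpos_mxsub id e mn0 mn0 up; congr mpos.
apply/matrixP=> i j; rewrite !mxE /e /=.
case: (split i) => i'; rewrite !mxE; case: (split j) => j';
  by rewrite ?mxE ?(mulr1, mulrN1, mul1r, opprK, rmorphN, rmorph1, scale1r,
    scaleN1r).
Qed.

(** * The order unit, and unitaries multiplied by scalar unitaries *)

Lemma munit1 (R : realType) (V : matrixOrderUnitType R) :
  munit V 1 = const_mx ounit.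
Proof. by apply/matrixP=> i j; rewrite /munit !mxE !ord1. Qed.

Lemma munit_pos (R : realType) (V : absMatrixOrderUnitType R) n :
  (0 < n)%N -> mpos (munit V n).
Proof.
case: n => // n _; elim: n => [|n IH].
  by rewrite munit1; apply: ounit_pos.
rewrite -(munit_dsum V 1 n.+1); apply: (@mpos_dsum _ _ 1 n.+1) => //.
by rewrite munit1; apply: ounit_pos.
Qed.

(** Used to trade a right factor of the unit for a left one, the side on which [mxabs_lmulV]
    applies. *)
Lemma lmulV_munit (R : realType) (V : matrixOrderUnitType R) m n
    (a : 'M[R[i]]_(m, n)) : lmulV a (munit V n) = rmulV (munit V m) a.
Proof.
rewrite /munit; apply/matrixP=> i j; rewrite !mxE.
rewrite (bigD1 j) //= big1 => [|k /negPf kj].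
  rewrite (bigD1 i) //= big1 => [|k /negPf ki]; first by rewrite !mxE !eqxx.
  by rewrite !mxE eq_sym ki scaler0.
by rewrite !mxE kj scaler0.
Qed.

(** Right multiplication does not fix absolute values as left multiplication does: the expected
    value is [b* |v| b], which is the unit when [|v|] is. Each inequality is derived from
    [mxabs_mul]. *)
Lemma mxabs_rmulV_munit (R : realType) (V : absMatrixOrderUnitType R) n
    (v : 'M[V]_n) (b : 'M[R[i]]_n) :
  (0 < n)%N -> isometry b -> isometry (adjmx b) ->
  mxabs v = munit V n -> mxabs (rmulV v b) = munit V n.
Proof.
move=> n0 bI bJ vE.
have I1 : isometry (1%:M : 'M[R[i]]_n) by rewrite /isometry adjmx1 mulmx1.
have eP := munit_pos V n0.
have le (w : 'M[V]_n) (c : 'M_n) : isometry c -> isometry (adjmx c) ->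
    mle (mxabs (rmulV w c)) (mxabs (rmulV (mxabs w) c)).
  by move=> cI cJ; have := mle_mxabs_mul w c n0 n0 n0 n0 I1; rewrite lmul1V.
apply: mle_anti => //.
  (* Upper bound: [|v b| <= |e b| = |b e| = |e| = e], with [e] the matrix unit. *)
  have := le v b bI bJ; rewrite vE -lmulV_munit mxabs_lmulV //.
  by rewrite (mxabs_id n0 eP).
(* Lower bound: [e = |v b b*| <= |p b*| = |b p b*| = b p b*], the last matrix being positive.
   Conjugating by [b] then gives [e <= p]. *)
set p := mxabs (rmulV v b).
have pP : mpos p by apply: mxabs_pos.
have := le (rmulV v b) (adjmx b) bJ; rewrite adjmxK => /(_ bI).
rewrite rmulVA.
have -> : b *m adjmx b = 1%:M by have := bJ; rewrite /isometry adjmxK.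
rewrite rmulV1 vE -/p -(mxabs_lmulV (a := b) (rmulV p _)) //.
rewrite lrmulVA mxabs_id //; last first.
  by rewrite -{1}[b]adjmxK; apply: mpos_compat.
move=> /(mle_conj b n0 n0).
rewrite lmulV_munit rmulVA bI rmulV1.
by rewrite lrmulVA lmulVA bI lmul1V rmulVA bI rmulV1.
Qed.

Lemma is_unitary_lmulV (R : realType) (V : absMatrixOrderUnitType R) n
    (a : 'M[R[i]]_n) (u : 'M[V]_n) : (0 < n)%N ->
  isometry a -> isometry (adjmx a) -> is_unitary u -> is_unitary (lmulV a u).
Proof.
move=> n0 aI aJ [u1 u2]; split; first by rewrite mxabs_lmulV.
by rewrite mxstar_lmulV mxabs_rmulV_munit // adjmxK.
Qed.

Lemma is_unitary_mxstar (R : realType) (V : absMatrixOrderUnitType R) n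
    (u : 'M[V]_n) : is_unitary u -> is_unitary (mxstar u).
Proof. by case=> u1 u2; split; rewrite // mxstarK. Qed.

(** The involution preserves unitaries and exchanges left and right multiplication, which reduces
    this side to the left one. *)
Lemma is_unitary_rmulV (R : realType) (V : absMatrixOrderUnitType R) n
    (u : 'M[V]_n) (a : 'M[R[i]]_n) : (0 < n)%N ->
  isometry a -> isometry (adjmx a) -> is_unitary u -> is_unitary (rmulV u a).
Proof.
move=> n0 aI aJ /is_unitary_mxstar uU.
rewrite -[rmulV u a]mxstarK mxstar_rmulV.
by apply: is_unitary_mxstar; apply: is_unitary_lmulV; rewrite ?adjmxK.
Qed.

Lemma is_unitary_munit (R : realType) (V : absMatrixOrderUnitType R) n :
  (0 < n)%N -> is_unitary (munit V n).
Proof.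
move=> n0; have eP := munit_pos V n0.
by split; rewrite ?(mpos_selfadjoint _ n0 _ eP) mxabs_id.
Qed.

(* Flipping the sign of the off-diagonal corners preserves positivity, so a
   positive 2 x 2 block matrix is at most twice its diagonal part. *)
Lemma mle_block_diag (R : realType) (V : matrixOrderedType R) m n
    (p : 'M[V]_(m + n)) : (0 < m)%N -> mpos p ->
  mle p (scmx 2 (dsum (ulsubmx p) (drsubmx p))).
Proof.
move=> m0; rewrite -{1}[p]submxK => /(mpos_block_sign m0); congr mpos.
rewrite -[X in _ - X]submxK /dsum scmx_block opp_block_mx add_block_mx.
rewrite -[2](natrD _ 1 1) !scmxDl !scmx1 !addr0.
by rewrite !add0r !addrK.
Qed.

(** * Order units at every matrix size *)

Lemma mle_munit (R : realType) (V : absMatrixOrderUnitType R) n (k l : R) :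
  (0 < n)%N -> k <= l -> mle (scmx k (munit V n)) (scmx l (munit V n)).
Proof.
move=> n0 kl; rewrite /mle -scmxNl -scmxDl.
by apply: mposZ; rewrite ?subr_ge0 //; apply: munit_pos.
Qed.

Lemma mpos_order_unit1 (R : realType) (V : absMatrixOrderUnitType R)
    (p : 'M[V]_1) : mpos p -> exists2 k : R, 0 < k & mle p (scmx k (munit V 1)).
Proof.
move=> pP; have sp : star (p 0 0) = p 0 0.
  by have /matrixP/(_ 0 0) := mpos_selfadjoint _ (ltn0Sn 0) _ pP; rewrite !mxE.
have [k k0 [_ kp]] := ounitP _ sp; exists k => //.
move: kp; rewrite /vpos /mle /=; congr mpos.
by apply/matrixP=> i j; rewrite munit1 !mxE !ord1.
Qed.

(** Induction on the size, splitting off a 1 x 1 corner: both diagonal corners are dominated by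
    multiples of the unit, and [mle_block_diag] controls the whole matrix by them. *)
Lemma mpos_order_unit (R : realType) (V : absMatrixOrderUnitType R) n
    (p : 'M[V]_n) : (0 < n)%N -> mpos p ->
  exists2 k : R, 0 < k & mle p (scmx k (munit V n)).
Proof.
case: n p => // n p _; elim: n p => [|n IH] p pP; first exact: mpos_order_unit1.
rewrite -[n.+2]/(1 + n.+1)%N in p pP *.
have [k k0 kp] := mpos_order_unit1 (mpos_ulsub (ltn0Sn 0) pP).
have [l l0 lp] := IH _ (mpos_drsub (ltn0Sn n) pP).
(* The 2 comes from [mle_block_diag]; [k + l] bounds both corners at once. *)
exists (2 * (k + l)); first by rewrite mulr_gt0 ?addr_gt0.
apply: mle_trans (mle_block_diag (ltn0Sn 0) pP) _ => //.
rewrite /mle -scmxA -scmxNr -scmxDr; apply: mposZ => //.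
rewrite -munit_dsum scmx_dsum opp_dsum add_dsum; apply: mpos_dsum => //.
  by apply: mle_trans kp (mle_munit _ _ _) => //; rewrite lerDl ltW.
by apply: mle_trans lp (mle_munit _ _ _) => //; rewrite lerDr ltW.
Qed.

(** * Bounds for the matrix norms *)

(** The condition inside the infimum [mnorm], without [0 < k], so that 0 bounds the zero matrix.
    Estimates are carried out on such bounds and reach [mnorm] only through [mnorm_ltP]. *)
Definition mnorm_bound (R : realType) (V : matrixOrderUnitType R) n
    (k : R) (v : 'M[V]_n) : Prop :=
  mpos (block_mx (scmx k (munit V n)) v (mxstar v) (scmx k (munit V n))).

Lemma scmx_munitD (R : realType) (V : matrixOrderUnitType R) n (k : R) :
  scmx k (munit V (n + n)) =
  block_mx (scmx k (munit V n)) 0 0 (scmx k (munit V n)).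
Proof. by rewrite -munit_dsum scmx_dsum. Qed.

Lemma mnorm_bound0 (R : realType) (V : absMatrixOrderUnitType R) n (k : R) :
  (0 < n)%N -> 0 <= k -> mnorm_bound k (0 : 'M[V]_n).
Proof.
move=> n0 k0; rewrite /mnorm_bound mxstar0 -scmx_munitD.
by apply: mposZ (munit_pos _ _); rewrite // addn_gt0 n0.
Qed.

Lemma mnorm_boundD (R : realType) (V : matrixOrderUnitType R) n (k l : R)
    (v w : 'M[V]_n) : (0 < n)%N ->
  mnorm_bound k v -> mnorm_bound l w -> mnorm_bound (k + l) (v + w).
Proof.
move=> n0 kv lw; rewrite /mnorm_bound mxstarD scmxDl -add_block_mx.
by apply: mposD; rewrite // addn_gt0 n0.
Qed.

Lemma mnorm_bound_le (R : realType) (V : absMatrixOrderUnitType R) n (k l : R)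
    (v : 'M[V]_n) : (0 < n)%N -> k <= l -> mnorm_bound k v -> mnorm_bound l v.
Proof.
move=> n0 kl kv; rewrite -[v]addr0 -(subrKC k l).
by apply: mnorm_boundD => //; apply: mnorm_bound0; rewrite ?subr_ge0.
Qed.

Lemma mnorm_boundZ (R : realType) (V : matrixOrderUnitType R) n (k r : R)
    (v : 'M[V]_n) : (0 < n)%N ->
  mnorm_bound k v -> mnorm_bound (`|r| * k) (scmx r v).
Proof.
move=> n0; have nn0 : (0 < n + n)%N by rewrite addn_gt0 n0.
rewrite /mnorm_bound mxstar_scmx -scmxA.
have [r0|r0] := leP 0 r => kv.
  by rewrite ger0_norm // -scmx_block; apply: mposZ.
(* For negative [r] the sign is moved to the off-diagonal corners, where [mpos_block_sign] absorbs
   it. *)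
rewrite ltr0_norm // -[r in scmx r v]opprK -[r in scmx r (mxstar v)]opprK.
rewrite !(scmxNl (- r)) -!scmxNr -scmx_block; apply: mposZ => //.
  by rewrite oppr_ge0 ltW.
exact: mpos_block_sign.
Qed.

(** The matrix [w] with off-diagonal corners [v] and [v*] is self-adjoint. Adding [|w| + w >= 0] to
    [k e - |w| >= 0] gives [k e + w >= 0], with [e] the unit of size [n + n]. *)
Lemma mnorm_bound_exists (R : realType) (V : absMatrixOrderUnitType R) n
    (v : 'M[V]_n) : (0 < n)%N -> exists2 k : R, 0 < k & mnorm_bound k v.
Proof.
move=> n0; have nn0 : (0 < n + n)%N by rewrite addn_gt0 n0.
pose w : 'M[V]_(n + n) := block_mx 0 v (mxstar v) 0.
have wS : selfadjoint w.
  rewrite /selfadjoint /= /mxstar /w tr_block_mx map_block_mx.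
  by rewrite -!/(mxstar _) !mxstar0 mxstarK.
have [k k0 wk] := mpos_order_unit nn0 (mxabs_pos _ _ w nn0 nn0).
exists k => //; have [+ _] := ao_pm (mxabs_ordered _ nn0) wS.
move=> /(mposD nn0 wk); rewrite addrA subrK scmx_munitD add_block_mx.
by rewrite !add0r !addr0.
Qed.

Lemma mnorm_bound_dsum (R : realType) (V : absMatrixOrderUnitType R) m n (k : R)
    (v : 'M[V]_m) (w : 'M[V]_n) : (0 < m)%N -> (0 < n)%N ->
  mnorm_bound k v -> mnorm_bound k w -> mnorm_bound k (dsum v w).
Proof.
move=> m0 n0 kv kw.
have mm0 : (0 < m + m)%N by rewrite addn_gt0 m0.
have nn0 : (0 < n + n)%N by rewrite addn_gt0 n0.
have mn0 : (0 < (m + n) + (m + n))%N by rewrite !addn_gt0 m0.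
(* [f] exchanges the two middle blocks of indices; compressing along it turns the direct sum of the
   block matrices of [v] and [w] into the block matrix of [dsum v w]. *)
pose f (i : 'I_((m + n) + (m + n))) : 'I_((m + m) + (n + n)) :=
  match split i with
  | inl i => match split i with
             | inl i => lshift _ (lshift _ i) | inr i => rshift _ (lshift _ i)
             end
  | inr i => match split i with
             | inl i => lshift _ (rshift _ i) | inr i => rshift _ (rshift _ i)
             end
  end.
have := mpos_mxsub f (fun=> 1) mn0 _ (mpos_dsum mm0 nn0 kv kw).
rewrite addn_gt0 mm0 => /(_ isT); congr mpos.
apply/matrixP=> i j; rewrite mxE mulr1 scale1r mxstar_dsum.
rewrite -munit_dsum scmx_dsum.
rewrite /f /dsum.
case: (split_ordP i) => i' ->; rewrite ?unsplitK;
case: (split_ordP i') => i'' ->; rewrite ?unsplitK;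
case: (split_ordP j) => j' ->; rewrite ?unsplitK;
case: (split_ordP j') => j'' ->;
by rewrite ?(block_mxEul, block_mxEur, block_mxEdl, block_mxEdr) ?mxE.
Qed.

Lemma mnorm_ltP (R : realType) (V : absMatrixOrderUnitType R) n (v : 'M[V]_n)
    (eps : R) : (0 < n)%N -> 0 < eps ->
  mnorm v < eps <-> exists2 k, k < eps & mnorm_bound k v.
Proof.
move=> n0 e0; split=> [|[k ke kv]].
  move=> /inf_lt [|k [k0 kv] ke]; last by exists k.
  by have [k k0 kv] := mnorm_bound_exists v n0; exists k; split.
(* The infimum ranges over positive numbers while [k] may not be positive, so [k] is raised to some
   [l] with [0 < l < eps]. *)
pose l := Num.max ((k + eps) / 2) (eps / 2).
have le : l < eps by rewrite /l gt_max; apply/andP; split; lra.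
apply: le_lt_trans le; apply: ge_inf; first by exists 0 => x [/ltW].
split; first by rewrite /l lt_max; apply/orP; right; lra.
by apply: mnorm_bound_le kv; rewrite // /l le_max; apply/orP; left; lra.
Qed.

(** * Homotopy of unitaries *)

Lemma homotopic_refl (R : realType) (V : absMatrixOrderUnitType R) n
    (u : 'M[V]_n) : (0 < n)%N -> is_unitary u -> homotopic u u.
Proof.
move=> n0 uU; exists (fun=> u); split=> // t _ eps e0; exists 1 => // s _ _.
by apply/mnorm_ltP => //; exists 0; rewrite // subrr; apply: mnorm_bound0.
Qed.

Lemma homotopic_sym (R : realType) (V : absMatrixOrderUnitType R) n
    (u v : 'M[V]_n) : homotopic u v -> homotopic v u.
Proof.
case=> f [f0 f1 fU fC]; exists (fun t => f (1 - t)); split.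
- by rewrite subr0.
- by rewrite subrr.
- by move=> t t01; apply: fU; lra.
move=> t t01 eps e0; have [|d d0 fd] := fC (1 - t) _ eps e0; first lra.
exists d => // s s01 st; apply: fd; first lra.
by rewrite opprD opprK addrACA subrr add0r addrC distrC.
Qed.

Lemma homotopic_trans (R : realType) (V : absMatrixOrderUnitType R) n
    (u v w : 'M[V]_n) : homotopic u v -> homotopic v w -> homotopic u w.
Proof.
case=> f [f0 f1 fU fC] [g [g0 g1 gU gC]].
exists (fun t => if t <= 1 / 2 then f (2 * t) else g (2 * t - 1)); split.
- by rewrite ifT ?mulr0 //; lra.
- have -> : 2 * 1 - 1 = 1 :> R by lra.
  by rewrite leNgt ifF //; apply/negbF; lra.
- by move=> t t01; case: leP => ht; [apply: fU | apply: gU]; lra.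
move=> t t01 eps e0; have [ht|ht|tE] := ltgtP t (1 / 2).
- have [|d d0 fd] := fC (2 * t) _ eps e0; first lra.
  (* The double speed halves [d]; the second term keeps [s] on the same side of 1/2 as [t]. *)
  exists (Num.min (d / 2) (1 / 2 - t)); first by rewrite lt_min; lra.
  move=> s s01; rewrite lt_min !ltr_norml => /andP[s1 s2].
  rewrite ifT; last lra.
  by apply: fd; [lra|rewrite ltr_norml; lra].
- have [|d d0 gd] := gC (2 * t - 1) _ eps e0; first lra.
  exists (Num.min (d / 2) (t - 1 / 2)); first by rewrite lt_min; lra.
  move=> s s01; rewrite lt_min !ltr_norml => /andP[s1 s2].
  rewrite leNgt ifF; last by apply/negbF; lra.
  by apply: gd; [lra|rewrite ltr_norml; lra].
(* At the junction, continuity of [f] at 1 handles [s <= 1/2] and continuity of [g] at 0 handles the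
   rest, since both paths take the value [v] there. *)
have tf : 2 * t = 1 by lra.
have tg : 2 * t - 1 = 0 by lra.
have [|d d0 fd] := fC 1 _ eps e0; first lra.
have [|d' d'0 gd] := gC 0 _ eps e0; first lra.
exists (Num.min (d / 2) (d' / 2)); first by rewrite lt_min; lra.
move=> s s01; rewrite lt_min !ltr_norml => /andP[s1 s2].
rewrite tf; case: (leP s (1 / 2)) => hs.
  by apply: fd; [lra|rewrite ltr_norml; lra].
by rewrite f1 -g0; apply: gd; [lra|rewrite ltr_norml; lra].
Qed.

Lemma homotopic_dsum (R : realType) (V : absMatrixOrderUnitType R) m n
    (u u' : 'M[V]_m) (v v' : 'M[V]_n) : (0 < m)%N -> (0 < n)%N ->
  homotopic u u' -> homotopic v v' -> homotopic (dsum u v) (dsum u' v').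
Proof.
move=> m0 n0 [f [f0 f1 fU fC]] [g [g0 g1 gU gC]].
exists (fun t => dsum (f t) (g t)); split; rewrite ?f0 ?f1 ?g0 ?g1 //.
  by move=> t t01; apply: is_unitary_dsum; [| |apply: fU|apply: gU].
move=> t t01 eps e0.
have [d d0 fd] := fC t t01 eps e0; have [d' d'0 gd] := gC t t01 eps e0.
exists (Num.min d d'); first by rewrite lt_min d0.
move=> s s01; rewrite lt_min => /andP[/(fd s s01) + /(gd s s01)].
move=> /(mnorm_ltP _ m0 e0)[k ke kf] /(mnorm_ltP _ n0 e0)[l le lg].
apply/mnorm_ltP; rewrite ?addn_gt0 ?m0 //.
exists (Num.max k l); first by rewrite gt_max ke.
rewrite opp_dsum add_dsum; apply: mnorm_bound_dsum => //.
  by apply: mnorm_bound_le kf; rewrite // le_max lexx.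
by apply: mnorm_bound_le lg; rewrite // le_max lexx orbT.
Qed.

(** * Rotation paths by scalar unitaries *)

(** The path follows the quarter circle from (1, 0) to (0, 1) in its rational parametrisation, so
    continuity reduces to algebraic Lipschitz estimates for the two coordinates. *)
Lemma homotopic_circle (R : realType) (V : absMatrixOrderUnitType R) n
    (A B : 'M[V]_n) : (0 < n)%N ->
  (forall c s : R, c ^+ 2 + s ^+ 2 = 1 -> is_unitary (scmx c A + scmx s B)) ->
  homotopic A B.
Proof.
move=> n0 AB.
have D0 (t : R) : 1 + t ^+ 2 != 0 by rewrite gt_eqF // ltr_wpDr ?sqr_ge0.
have V0 (t : R) : 0 <= (1 + t ^+ 2)^-1 <= 1.
  have h : 1 <= 1 + t ^+ 2 by rewrite lerDl sqr_ge0.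
  by rewrite invr_ge0 invf_le1 ?h ?(le_trans ler01 h) //; apply: lt_le_trans h.
(* Both difference quotients below have this shape, with a numerator [z] of size at most 4 on [0, 1]
   and denominators at least 1; hence the Lipschitz constant 4. *)
have L4 (x y z : R) : `|z| <= 4 ->
    `|z * ((1 + x ^+ 2)^-1 * (1 + y ^+ 2)^-1)| <= 4.
  move=> z4; have /andP[x0 x1] := V0 x; have /andP[y0 y1] := V0 y.
  rewrite normrM [X in _ * X]ger0_norm ?mulr_ge0 // -[4]mulr1.
  by apply: ler_pM => //; rewrite ?mulr_ge0 ?mulr_ile1.
pose c (t : R) := (1 - t ^+ 2) / (1 + t ^+ 2).
pose s (t : R) := (2 * t) / (1 + t ^+ 2).
have cL (x y : R) : 0 <= x <= 1 -> 0 <= y <= 1 -> `|c x - c y| <= 4 * `|x - y|.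
  move=> x01 y01; have -> : c x - c y =
      (x - y) * (- 2 * (x + y) * ((1 + x ^+ 2)^-1 * (1 + y ^+ 2)^-1)).
    by rewrite /c; field; rewrite !D0.
  by rewrite normrM mulrC ler_wpM2r // L4 // ler_norml; lra.
have sL (x y : R) : 0 <= x <= 1 -> 0 <= y <= 1 -> `|s x - s y| <= 4 * `|x - y|.
  move=> x01 y01; have -> : s x - s y =
      (x - y) * (2 * (1 - x * y) * ((1 + x ^+ 2)^-1 * (1 + y ^+ 2)^-1)).
    by rewrite /s; field; rewrite !D0.
  by rewrite normrM mulrC ler_wpM2r // L4 // ler_norml; nra.
exists (fun t => scmx (c t) A + scmx (s t) B); split.
- rewrite /c /s expr0n /= mulr0 mul0r subr0 addr0 divr1.
  by rewrite scmx1 scmx0l addr0.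
- rewrite /c /s expr1n subrr mul0r mulr1 divff ?scmx1 ?scmx0l ?add0r //.
  by rewrite pnatr_eq0.
- by move=> t _; apply: AB; rewrite /c /s; field.
move=> t t01 eps e0.
have [k k0 kA] := mnorm_bound_exists A n0.
have [l l0 lB] := mnorm_bound_exists B n0.
exists (eps / (4 * (k + l))); first by rewrite divr_gt0 ?mulr_gt0 ?addr_gt0.
move=> r r01; rewrite ltr_pdivlMr ?mulr_gt0 ?addr_gt0 // => rt.
apply/mnorm_ltP => //; exists (`|c r - c t| * k + `|s r - s t| * l).
  apply: le_lt_trans rt.
  rewrite mulrCA mulrA mulrDr.
  by apply: lerD; apply: ler_wpM2r (ltW _) _ _ _ => //; [apply: cL|apply: sL].
rewrite (_ : _ - _ = scmx (c r - c t) A + scmx (s r - s t) B).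
  by apply: mnorm_boundD => //; apply: mnorm_boundZ.
by rewrite !scmxDl !scmxNl opprD addrACA.
Qed.

Lemma adjmxD (R : realType) m n (a b : 'M[R[i]]_(m, n)) :
  adjmx (a + b) = adjmx a + adjmx b.
Proof. by rewrite /adjmx raddfD map_mxD. Qed.

Lemma adjmxZ (R : realType) m n (k : R) (a : 'M[R[i]]_(m, n)) :
  adjmx (k%:C *: a) = k%:C *: adjmx a.
Proof.
apply/matrixP=> i j; rewrite !mxE rmorphM; congr (_ * _).
exact: conjc_real.
Qed.

(** The hypotheses give [T T = -1], so [T] behaves like the imaginary unit and
    [(c - s T)(c + s T) = c^2 + s^2]. Taking the adjoint only replaces [s] by [- s], so one
    computation serves both claims. *)
Lemma isometry_rotation (R : realType) n (T : 'M[R[i]]_n) (c s : R) :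
  isometry T -> adjmx T = - T -> c ^+ 2 + s ^+ 2 = 1 ->
  isometry (c%:C *: 1%:M + s%:C *: T) /\
  isometry (adjmx (c%:C *: 1%:M + s%:C *: T)).
Proof.
rewrite /isometry => TI TN; have TT : T *m T = - 1%:M.
  by rewrite -TI TN mulNmx opprK.
have adjE (r : R) :
    adjmx (c%:C *: 1%:M + r%:C *: T) = c%:C *: 1%:M + (- r)%:C *: T.
  by rewrite adjmxD !adjmxZ adjmx1 TN rmorphN scaleNr scalerN.
have main (r : R) : c ^+ 2 + r ^+ 2 = 1 ->
    (c%:C *: 1%:M + (- r)%:C *: T) *m (c%:C *: 1%:M + r%:C *: T) = 1%:M.
  move=> cr; rewrite mulmxDl !mulmxDr -!scalemxAl -!scalemxAr !mul1mx mulmx1 TT.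
  rewrite !scalerA rmorphN !mulNr !scaleNr [r%:C * c%:C]mulrC addrA addrK.
  by rewrite scalerN opprK -scalerDl -!expr2 -!rmorphXn -rmorphD cr scale1r.
move=> cs; rewrite adjE main // adjE; split => //.
by apply: main; rewrite sqrrN.
Qed.

Lemma homotopic_lmulV (R : realType) (V : absMatrixOrderUnitType R) n
    (T : 'M[R[i]]_n) (u : 'M[V]_n) : (0 < n)%N ->
  isometry T -> adjmx T = - T -> is_unitary u -> homotopic u (lmulV T u).
Proof.
move=> n0 TI TN uU; apply: homotopic_circle => // c s cs.
have [aI aJ] := isometry_rotation TI TN cs.
have := is_unitary_lmulV n0 aI aJ uU.
by rewrite lmulVDl !lmulV_scmx lmul1V.
Qed.

Lemma homotopic_rmulV (R : realType) (V : absMatrixOrderUnitType R) n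
    (T : 'M[R[i]]_n) (u : 'M[V]_n) : (0 < n)%N ->
  isometry T -> adjmx T = - T -> is_unitary u -> homotopic u (rmulV u T).
Proof.
move=> n0 TI TN uU; apply: homotopic_circle => // c s cs.
have [aI aJ] := isometry_rotation TI TN cs.
have := is_unitary_rmulV n0 aI aJ uU.
by rewrite rmulVDr !rmulV_scmx rmulV1.
Qed.

(** * Reversal of the basis, stabilisation, and commutativity up to homotopy *)

Definition mxrev (T : Type) m n (u : 'M[T]_(m, n)) : 'M[T]_(m, n) :=
  \matrix_(i, j) u (rev_ord i) (rev_ord j).

(* With S the antidiagonal permutation matrix and T = iS, the entries of
   [mxrev u] are those of SuS = Tu(-T), and T is a skew-adjoint unitary. *)
Lemma homotopic_mxrev (R : realType) (V : absMatrixOrderUnitType R) n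
    (u : 'M[V]_n) : (0 < n)%N -> is_unitary u -> homotopic u (mxrev u).
Proof.
move=> n0 uU; pose S : 'M[R[i]]_n := \matrix_(i, j) (j == rev_ord i)%:R.
have SS : S *m S = 1%:M.
  apply/matrixP=> i j; rewrite !mxE (bigD1 (rev_ord i)) //= big1 ?addr0.
    by rewrite !mxE rev_ordK eqxx mul1r eq_sym.
  by move=> k /negPf ki; rewrite !mxE ki mul0r.
have SA : adjmx S = S.
  apply/matrixP=> i j; rewrite !mxE -(can_eq (@rev_ordK n)) rev_ordK eq_sym.
  by rewrite conjc_nat.
pose T := ('i%C : R[i]) *: S.
have TN : adjmx T = - T.
  have -> : adjmx T = conjc 'i%C *: adjmx S.
    by apply/matrixP=> i j; rewrite !mxE rmorphM.
  by rewrite SA -scaleNr; congr (_ *: _); simpc.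
have TI : isometry T.
  rewrite /isometry TN mulNmx -scalemxAl -scalemxAr SS scalerA -expr2 sqr_i.
  by rewrite scaleN1r opprK.
have NN : adjmx (- T) = - - T by rewrite -{1}TN adjmxK opprK.
have NI : isometry (- T) by rewrite /isometry NN opprK mulmxN -mulNmx -TN.
have TU : is_unitary (lmulV T u).
  by apply: is_unitary_lmulV; rewrite // TN.
apply: homotopic_trans (homotopic_lmulV n0 TI TN uU) _.
suff -> : mxrev u = rmulV (lmulV T u) (- T) by apply: homotopic_rmulV.
apply/matrixP=> i j; rewrite !mxE.
rewrite (bigD1 (rev_ord j)) //= big1 ?addr0; last first.
  by move=> k /negPf kj; rewrite !mxE eq_sym -(can_eq (@rev_ordK n)) rev_ordK kj
    mulr0 oppr0 scale0r.
rewrite !mxE (bigD1 (rev_ord i)) //= big1 ?addr0; last first.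
  by move=> k /negPf ki; rewrite !mxE ki mulr0 scale0r.
by rewrite !mxE rev_ordK !eqxx !mulr1 scalerA mulNr -expr2 sqr_i opprK scale1r.
Qed.
(* The entries of the infinite matrix u (+) e (+) e (+) ..., whose corners
   [stab N u] are comparable without casts between sizes. *)
Definition mxent (R : realType) (V : matrixOrderUnitType R) n (u : 'M[V]_n)
    (i j : nat) : V :=
  match insub i, insub j with
  | Some a, Some b => u a b
  | _, _ => if i == j then ounit else 0
  end.

Definition stab (R : realType) (V : matrixOrderUnitType R) n (N : nat)
  (u : 'M[V]_n) : 'M[V]_N := \matrix_(i, j) mxent u i j.

Lemma mxentE (R : realType) (V : matrixOrderUnitType R) n (u : 'M[V]_n)
    (i j : 'I_n) : mxent u i j = u i j.
Proof. by rewrite /mxent !valK. Qed.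

Lemma mxent_out (R : realType) (V : matrixOrderUnitType R) n (u : 'M[V]_n) i j :
  ~~ ((i < n) && (j < n))%N -> mxent u i j = if i == j then ounit else 0.
Proof.
by rewrite /mxent; case: insubP => [a -> _|//]; case: insubP => [b ->|].
Qed.

Lemma mxent_dsum (R : realType) (V : matrixOrderUnitType R) m n
    (u : 'M[V]_m) (v : 'M[V]_n) i j :
  mxent (dsum u v) i j =
  if (i < m)%N then (if (j < m)%N then mxent u i j else 0)
  else if (j < m)%N then 0 else mxent v (i - m) (j - m).
Proof.
have [/andP[imn jmn]|ij] := boolP ((i < m + n) && (j < m + n))%N.
  rewrite -[ i]/(nat_of_ord (Ordinal imn)) -[j]/(nat_of_ord (Ordinal jmn)).
  rewrite mxentE.
  case: (split_ordP (Ordinal imn)) => i' ->;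
  case: (split_ordP (Ordinal jmn)) => j' ->;
  rewrite ?(block_mxEul, block_mxEur, block_mxEdl, block_mxEdr) /=;
  by rewrite ?ltn_ord ?[(m + _ < m)%N]ltnNge ?leq_addr //= ?addKn ?mxentE ?mxE.
(* Outside the corner of size [m + n] the entries are those of the identity: in the mixed cases [i]
   and [j] differ, and subtracting [m] from both preserves whether they are equal. *)
rewrite mxent_out //; case: ltnP => im; case: ltnP => jm.
- by case/negP: ij; rewrite !ltn_addr.
- by rewrite ltn_eqF // (leq_trans im).
- by rewrite gtn_eqF // (leq_trans jm).
- rewrite mxent_out; last by move: ij; rewrite !ltn_subLR.
  by have -> : (i - m == j - m)%N = (i == j) by lia.
Qed.

Lemma mxent_stab (R : realType) (V : matrixOrderUnitType R) n N
    (u : 'M[V]_n) i j :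
  (n <= N)%N -> mxent (stab N u) i j = mxent u i j.
Proof.
move=> nN; have [/andP[iN jN]|ij] := boolP ((i < N) && (j < N))%N.
  rewrite -[ i]/(nat_of_ord (Ordinal iN)) -[j]/(nat_of_ord (Ordinal jN)).
  by rewrite mxentE mxE.
rewrite !mxent_out //; apply: contra ij => /andP[i1 i2].
by rewrite !(leq_trans _ nN).
Qed.

Lemma eq_stab (R : realType) (V : matrixOrderUnitType R) m n N
    (u : 'M[V]_m) (v : 'M[V]_n) :
  (forall i j, mxent u i j = mxent v i j) -> stab N u = stab N v.
Proof. by move=> uv; apply/matrixP=> i j; rewrite !mxE. Qed.

Lemma stab_id (R : realType) (V : matrixOrderUnitType R) n (u : 'M[V]_n) :
  stab n u = u.
Proof. by apply/matrixP=> i j; rewrite mxE mxentE. Qed.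

Lemma stab_stab (R : realType) (V : matrixOrderUnitType R) n N M (u : 'M[V]_n) :
  (n <= N)%N -> stab M (stab N u) = stab M u.
Proof. by move=> nN; apply: eq_stab => i j; rewrite mxent_stab. Qed.

Lemma mxent_munit (R : realType) (V : matrixOrderUnitType R) n i j :
  mxent (munit V n) i j = if i == j then ounit else 0.
Proof.
have [/andP[iN jN]|ij] := boolP ((i < n) && (j < n))%N; last exact: mxent_out.
rewrite -{1}[ i]/(nat_of_ord (Ordinal iN)) -{1}[j]/(nat_of_ord (Ordinal jN)).
rewrite mxentE.
by rewrite /munit !mxE -val_eqE /=; case: eqP.
Qed.

Lemma stab_addn (R : realType) (V : matrixOrderUnitType R) n d (u : 'M[V]_n) :
  stab (n + d) u = dsum u (munit V d).
Proof.
apply/matrixP=> i j; rewrite mxE -mxentE mxent_dsum mxent_munit.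
case: ltnP => im; case: ltnP => jm //.
- rewrite mxent_out ?ltn_eqF // ?(leq_trans im) //.
  by rewrite [(j < n)%N]ltnNge jm andbF.
- by rewrite mxent_out ?gtn_eqF // ?(leq_trans jm) // [(i < n)%N]ltnNge im.
- rewrite mxent_out; last by rewrite ltnNge im.
  by have -> : (i - n == j - n)%N = (i == j :> nat) by lia.
Qed.

(** Entries do not see the cast in [pad], so sizes can be compared through [stab] alone. *)
Lemma pad_stab (R : realType) (V : matrixOrderUnitType R) m k (mk : (m < k)%N)
    (u : 'M[V]_m) : pad mk u = stab k u.
Proof.
rewrite /pad -stab_addn; move: (subnKC _) => e.
by apply/matrixP=> i j; rewrite castmxE !mxE.
Qed.

Lemma is_unitary_stab (R : realType) (V : absMatrixOrderUnitType R) n N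
    (u : 'M[V]_n) : (0 < n)%N -> (n <= N)%N -> is_unitary u ->
  is_unitary (stab N u).
Proof.
move=> n0 nN uU; rewrite -(subnKC nN) stab_addn.
(* The case of no added block is separate, because nothing is known about unitaries of size 0. *)
case: (N - n)%N => [|d].
  by rewrite -stab_addn addn0 stab_id.
by apply: is_unitary_dsum => //; apply: is_unitary_munit.
Qed.

Lemma homotopic_stab (R : realType) (V : absMatrixOrderUnitType R) n N
    (u v : 'M[V]_n) : (0 < n)%N -> (n <= N)%N -> homotopic u v ->
  homotopic (stab N u) (stab N v).
Proof.
move=> n0 nN uv; rewrite -(subnKC nN) !stab_addn.
case: (N - n)%N => [|d].
  by rewrite -!stab_addn addn0 !stab_id.
apply: homotopic_dsum => //; apply: homotopic_refl => //.
exact: is_unitary_munit.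
Qed.

(** Reversing the basis puts the last block first. Here [stab (m + n)] adds no entries; it only
    retypes a matrix of size [n + m]. *)
Lemma mxrev_dsum (R : realType) (V : matrixOrderUnitType R) m n
    (u : 'M[V]_m) (v : 'M[V]_n) :
  mxrev (dsum u v) = stab (m + n) (dsum (mxrev v) (mxrev u)).
Proof.
have revE k (w : 'M[V]_k) i j : (i < k)%N -> (j < k)%N ->
    mxent (mxrev w) i j = mxent w (k - i.+1) (k - j.+1).
  move=> ik jk; rewrite -[ i]/(nat_of_ord (Ordinal ik)).
  by rewrite -[j]/(nat_of_ord (Ordinal jk)) mxentE mxE -mxentE.
apply/matrixP=> i j; rewrite [LHS]mxE [RHS]mxE -mxentE !mxent_dsum /=.
have := ltn_ord i; have := ltn_ord j.
move: (nat_of_ord i) (nat_of_ord j) => a b bl al.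
have [an|an] := ltnP a n; have [bn|bn] := ltnP b n;
have [cm|cm] := ltnP (m + n - a.+1) m; have [dm|dm] := ltnP (m + n - b.+1) m;
  try lia; rewrite ?revE //; try lia.
  by congr mxent; lia.
by congr mxent; lia.
Qed.

Lemma homotopic_dsumC (R : realType) (V : absMatrixOrderUnitType R) m n
    (u : 'M[V]_m) (v : 'M[V]_n) : (0 < m)%N -> (0 < n)%N ->
  is_unitary u -> is_unitary v ->
  homotopic (dsum u v) (stab (m + n) (dsum v u)).
Proof.
move=> m0 n0 uU vU.
have := homotopic_mxrev _ (is_unitary_dsum m0 n0 uU vU); rewrite mxrev_dsum.
rewrite addn_gt0 m0 => /(_ isT) /homotopic_trans; apply.
apply: homotopic_stab; rewrite ?addn_gt0 ?n0 ?[(n + m)%N]addnC //.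
by apply: homotopic_dsum => //; apply: homotopic_sym; apply: homotopic_mxrev.
Qed.

(** * The relation [sim1] as a congruence for [udsum] *)

Lemma stab_dsum (R : realType) (V : matrixOrderUnitType R) m n k
    (w : 'M[V]_m) (u : 'M[V]_n) : (n <= k)%N ->
  stab (m + k) (dsum w u) = dsum w (stab k u).
Proof.
move=> nk; apply/matrixP=> i j; rewrite mxE -mxentE !mxent_dsum.
by rewrite mxent_stab.
Qed.

Lemma sim1P (R : realType) (V : absMatrixOrderUnitType R) (u v : unitary V) :
  sim1 u v <-> exists k, [/\ (usize u <= k)%N, (usize v <= k)%N &
    homotopic (stab k (uval u)) (stab k (uval v))].
Proof.
split=> [[k [uk [vk]]]|[k [uk vk uv]]].
  by rewrite !pad_stab => uv; exists k; split; rewrite // ltnW.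
(* [sim1] asks for a size strictly above both, so one more unit is adjoined. *)
exists k.+1, (leq_ltn_trans uk (ltnSn k)), (leq_ltn_trans vk (ltnSn k)).
rewrite !pad_stab -(stab_stab _ _ uk) -(stab_stab _ _ vk).
by apply: homotopic_stab => //; apply: leq_trans uk; apply: usize_gt0.
Qed.

(** Covers unitaries whose sizes are equal only propositionally, such as reassociated sums: their
    stabilisations coincide and a constant path suffices. *)
Lemma eq_mxent_sim1 (R : realType) (V : absMatrixOrderUnitType R)
    (u v : unitary V) :
  (forall i j, mxent (uval u) i j = mxent (uval v) i j) -> sim1 u v.
Proof.
move=> uv; apply/sim1P; exists (usize u + usize v)%N.
split; rewrite ?leq_addr ?leq_addl // (eq_stab _ uv).
apply: homotopic_refl; rewrite ?addn_gt0 ?usize_gt0 //.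
by apply: is_unitary_stab; rewrite ?leq_addl ?usize_gt0 //; apply: unitaryP.
Qed.

#[local] Instance sim1_equivalence (R : realType)
    (V : absMatrixOrderUnitType R) :
  Equivalence (@sim1 R V).
Proof.
split=> [u|u v|u v w]; first exact: eq_mxent_sim1.
  move=> /sim1P[k [uk vk uv]]; apply/sim1P; exists k; split=> //.
  exact: homotopic_sym.
move=> /sim1P[k [uk vk uv]] /sim1P[l [vl wl vw]].
(* The two homotopies live at sizes [k] and [l]; both are stabilised to [k + l] before being
   concatenated. *)
apply/sim1P; exists (k + l)%N; split;
  rewrite ?(leq_trans uk) ?(leq_trans wl) ?leq_addr ?leq_addl //.
have k0 : (0 < k)%N by apply: leq_trans uk; apply: usize_gt0.
have l0 : (0 < l)%N by apply: leq_trans wl; apply: usize_gt0.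
have := homotopic_stab l0 (leq_addl k l) vw.
have := homotopic_stab k0 (leq_addr l k) uv.
by rewrite !stab_stab //; apply: homotopic_trans.
Qed.

#[local] Hint Extern 0 (sim1 _ _) => reflexivity : core.

Lemma udsumA (R : realType) (V : absMatrixOrderUnitType R) (u v w : unitary V) :
  sim1 (udsum u (udsum v w)) (udsum (udsum u v) w).
Proof.
apply: eq_mxent_sim1 => i j; rewrite /= !mxent_dsum -?subnDA.
case: (ltnP i (usize u)) => ?; case: (ltnP j (usize u)) => ?;
case: (ltnP (i - usize u) (usize v)) => ?;
case: (ltnP (j - usize u) (usize v)) => ?;
case: (ltnP i (usize u + usize v)) => ?;
case: (ltnP j (usize u + usize v)) => ? //; lia.
Qed.

Lemma udsumC (R : realType) (V : absMatrixOrderUnitType R) (u v : unitary V) :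
  sim1 (udsum u v) (udsum v u).
Proof.
apply/sim1P; exists (usize u + usize v)%N; split;
  rewrite //= 1?addnC // stab_id.
by apply: homotopic_dsumC; rewrite ?usize_gt0 //; apply: unitaryP.
Qed.

Lemma sim1_udsumr (R : realType) (V : absMatrixOrderUnitType R)
    (w u v : unitary V) : sim1 u v -> sim1 (udsum w u) (udsum w v).
Proof.
move=> /sim1P[k [uk vk uv]]; apply/sim1P; exists (usize w + k)%N.
rewrite /= !leq_add2l; split=> //; rewrite !stab_dsum //.
apply: homotopic_dsum => //; rewrite ?usize_gt0 //.
  by apply: leq_trans uk; apply: usize_gt0.
by apply: homotopic_refl; [apply: usize_gt0|apply: unitaryP].
Qed.

(** Allows rewriting by [sim1] inside sums; the left argument is moved to the right by
    commutativity. *)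
#[local] Instance udsum_proper (R : realType) (V : absMatrixOrderUnitType R) :
  Proper (@sim1 R V ==> @sim1 R V ==> @sim1 R V) (@udsum R V).
Proof.
move=> u u' uu v v' vv; rewrite (sim1_udsumr u vv).
by rewrite (udsumC u v') (sim1_udsumr v' uu) udsumC.
Qed.

Lemma udsumACA (R : realType) (V : absMatrixOrderUnitType R)
    (a b c d : unitary V) :
  sim1 (udsum (udsum a b) (udsum c d)) (udsum (udsum a c) (udsum b d)).
Proof.
by rewrite -!udsumA (udsumA b c d) (udsumC b c) -(udsumA c b d).
Qed.

(** * The Grothendieck group of classes of pairs *)

Lemma sim1_equiv1 (R : realType) (V : absMatrixOrderUnitType R)
    (p q : unitary V * unitary V) :
  sim1 (udsum p.1 q.2) (udsum q.1 p.2) -> equiv1 p q.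
(* Any unitary can serve as the auxiliary summand of [approx1]; [p.1] is one at hand. *)
Proof. by move=> pq; exists p.1; rewrite pq. Qed.

Lemma equiv1_equivalence (R : realType) (V : absMatrixOrderUnitType R) :
  Equivalence (@equiv1 R V).
Proof.
split=> [p|p q|[u1 v1] [u2 v2] [u3 v3]]; first exact: sim1_equiv1.
  by case=> w pq; exists w; symmetry.
(* Adding the two relations leaves [u2] and [v2] on both sides; they join [w] and [z] in the
   auxiliary summand, which gives the cancellation. *)
case=> w /= pq [z /= qr]; exists (udsum (udsum u2 v2) (udsum w z)).
have merge a b c d : sim1 (udsum (udsum (udsum a d) w) (udsum (udsum b c) z))
    (udsum (udsum a c) (udsum (udsum b d) (udsum w z))).
  by rewrite udsumACA (udsumC b c) (udsumACA a d) (udsumC d b) -udsumA.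
rewrite -merge pq qr (udsumC u2 v1) (udsumC u3 v2) merge.
by rewrite (udsumC v1 u3) (udsumC v2 u2).
Qed.

(** Makes addition of classes independent of representatives; the auxiliary summands of the two
    relations are added. *)
Lemma equiv1_dsum (R : realType) (V : absMatrixOrderUnitType R)
    (p p' q q' : unitary V * unitary V) : equiv1 p p' -> equiv1 q q' ->
  equiv1 (udsum p.1 q.1, udsum p.2 q.2) (udsum p'.1 q'.1, udsum p'.2 q'.2).
Proof.
case=> w pp [z qq]; exists (udsum w z) => /=.
by rewrite !(udsumACA _ _ _.2) !(udsumACA _ _ w) pp qq.
Qed.

Lemma K1_class_setP (R : realType) (V : absMatrixOrderUnitType R)
    (p q : unitary V * unitary V) :
  K1_class_set p = K1_class_set q <-> equiv1 p q.
Proof.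
have E := equiv1_equivalence V.
split=> [pq|pq].
  have : K1_class_set q q by rewrite /K1_class_set /=; reflexivity.
  by rewrite -pq.
apply/seteqP; split=> r /=; last by apply: Equivalence_Transitive.
by apply: Equivalence_Transitive; symmetry.
Qed.

Lemma K1_classP (R : realType) (V : absMatrixOrderUnitType R)
    (u u' v v' : unitary V) : equiv1 (u, v) (u', v') ->
  K1_class u v = K1_class u' v'.
Proof. by move=> /K1_class_setP e; apply: eq_exist. Qed.

Definition K1_repr (R : realType) (V : absMatrixOrderUnitType R) (A : K1 V) :
  unitary V * unitary V := projT1 (cid (proj2_sig A)).

Lemma K1_reprK (R : realType) (V : absMatrixOrderUnitType R) (A : K1 V) :
  K1_class (K1_repr A).1 (K1_repr A).2 = A.
Proof.
by case: A => A AE; apply: eq_exist; rewrite /K1_repr; case: cid => -[].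
Qed.

(** Reduces the group laws to classes of explicit pairs, on which [K1_addE] computes. *)
Lemma K1_ind (R : realType) (V : absMatrixOrderUnitType R) (P : K1 V -> Prop) :
  (forall u v, P (K1_class u v)) -> forall A, P A.
Proof. by move=> PK A; rewrite -[A]K1_reprK. Qed.

Lemma K1_reprP (R : realType) (V : absMatrixOrderUnitType R) (u v : unitary V) :
  equiv1 (K1_repr (K1_class u v)) (u, v).
Proof.
by apply/K1_class_setP; rewrite /K1_repr; case: cid => /= p <-.
Qed.

Definition K1_add (R : realType) (V : absMatrixOrderUnitType R) (A B : K1 V) :=
  K1_class (udsum (K1_repr A).1 (K1_repr B).1)
           (udsum (K1_repr A).2 (K1_repr B).2).

Lemma K1_addE (R : realType) (V : absMatrixOrderUnitType R)
    (u1 u2 v1 v2 : unitary V) :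
  K1_add (K1_class u1 v1) (K1_class u2 v2) =
  K1_class (udsum u1 u2) (udsum v1 v2).
Proof.
apply: K1_classP.
exact: equiv1_dsum (K1_reprP u1 v1) (K1_reprP u2 v2).
Qed.

Definition K1_opp (R : realType) (V : absMatrixOrderUnitType R) (A : K1 V) :=
  K1_class (K1_repr A).2 (K1_repr A).1.

(** A unitary that always exists, so that a pair with equal entries is available to represent
    zero. *)
Definition unitary1 (R : realType) (V : absMatrixOrderUnitType R) : unitary V :=
  Unitary (ltn0Sn 0) (is_unitary_munit V (ltn0Sn 0)).

Theorem theorem3p14 (R : realType) (V : absMatrixOrderUnitType R) :
  Equivalence (@equiv1 R V) /\
  exists add : K1 V -> K1 V -> K1 V,
    (forall u1 u2 v1 v2 : unitary V,
       add (K1_class u1 v1) (K1_class u2 v2) =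
       K1_class (udsum u1 u2) (udsum v1 v2)) /\
    is_abelian_group add.
Proof.
split; first exact: equiv1_equivalence.
exists (@K1_add R V); split; first exact: K1_addE.
pose e := unitary1 V; split.
- elim/K1_ind=> a a'; elim/K1_ind=> b b'; elim/K1_ind=> c c'; rewrite !K1_addE.
  by apply/K1_classP/sim1_equiv1 => /=; rewrite !udsumA.
- elim/K1_ind=> a a'; elim/K1_ind=> b b'; rewrite !K1_addE.
  by apply/K1_classP/sim1_equiv1 => /=; rewrite (udsumC a b) (udsumC a' b').
exists (K1_class e e), (@K1_opp R V); split.
  elim/K1_ind=> a a'; rewrite K1_addE; apply/K1_classP/sim1_equiv1 => /=.
  by rewrite (udsumC e a) -udsumA.
(* For [A] the class of [(u, v)], the sum is the class of [(v (+) u, u (+) v)], whose entries agree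
   up to [sim1] by commutativity; hence it is zero. *)
move=> A; rewrite /K1_opp -{3}[A]K1_reprK K1_addE; apply/K1_classP/sim1_equiv1.
by rewrite /= udsumC (udsumC (K1_repr A).2).
Qed.
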